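(* Let $G$ be a finite commutative group with $|G|=q$, and let $A_1,A_2\subset G$ be standard sets. Then \[ \lambda(A_1\cup A_2)\ge\lambda(A_1)\lambda(A_2),\qquad \lambda^+(A_1\cup A_2)\ge\lambda^+(A_1)\lambda^-(A_2), \] \[ \lambda^-(A_1\cup A_2)\ge\lambda^-(A_1)\lambda^-(A_2),\qquad \lambda^\pm(A_1\cup A_2)\ge\lambda^\pm(A_1)\lambda^-(A_2). \]
   Context: $G$ is written additively. A set $A\subset G$ is a standard set if $A=-A$ and $0\in A$. A character of $G$ is a homomorphism $\gamma:G\to\{z\in\mathbb C:|z|=1\}$; $\hat G$ is the group of characters and $\mathbf 1$ the principal character. For $f:G\to\mathbb R$, $\hat f(\gamma)=\sum_{x\in G}\gamma(x)f(x)$. Classes of functions $f:G\to\mathbb R$ not identically zero: $\mathcal S(A)$: $f=0$ on $G\setminus A$; $\mathcal S^-(A)$: $f\le0$ on $G\setminus A$; $\mathcal S^+(A)$: $f=0$ on $G\setminus A$, $f\ge0$ on $A$; $\mathcal S^\pm(A)$: $f\le0$ on $G\setminus A$, $f\ge0$ on $A$. $\lambda(A)=\min\{f(0)/\hat f(\mathbf 1): f\in\mathcal S(A),\ \hat f\ge0\text{ on }\hat G\}$, and $\lambda^-,\lambda^+,\lambda^\pm$ are defined likewise with $\mathcal S^-,\mathcal S^+,\mathcal S^\pm$. *)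

(* Defs.v *)
From HB Require Import structures.
From mathcomp Require Import all_boot all_order all_algebra.
From mathcomp Require Import complex.
From mathcomp Require Import mathcomp_extra boolp classical_sets reals.

Set Implicit Arguments.
Unset Strict Implicit.
Unset Printing Implicit Defensive.

Import Order.TTheory GRing.Theory Num.Theory.
Local Open Scope ring_scope.
Local Open Scope complex_scope.

Definition standard_set (G : finZmodType) (A : {set G}) : Prop :=
  A = -%R @: A /\ 0 \in A.

Definition is_character (R : realType) (G : finZmodType) (gamma : G -> R[i])
    : Prop :=
  (forall x y, gamma (x + y) = gamma x * gamma y) /\
  (forall x, `|gamma x| = 1).

Definition principal_character (R : realType) (G : finZmodType) : G -> R[i] :=
  fun=> 1.
Arguments principal_character : clear implicits.

Definition fourier (R : realType) (G : finZmodType) (f : G -> R)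
    (gamma : G -> R[i]) : R[i] :=
  \sum_(x : G) gamma x * (f x)%:C.

(* The order on R[i] is partial: 0 <= z means that z is real and nonnegative. *)
Definition fourier_nonneg (R : realType) (G : finZmodType) (f : G -> R)
    : Prop :=
  forall gamma : G -> R[i], is_character gamma -> 0 <= fourier f gamma.

Definition not_identically_zero (R : realType) (G : finZmodType) (f : G -> R)
    : Prop :=
  exists x, f x <> 0.

Definition class_S (R : realType) (G : finZmodType) (A : {set G}) (f : G -> R)
    : Prop :=
  not_identically_zero f /\ (forall x, x \notin A -> f x = 0).

Definition class_S_minus (R : realType) (G : finZmodType) (A : {set G})
    (f : G -> R) : Prop :=
  not_identically_zero f /\ (forall x, x \notin A -> f x <= 0).

Definition class_S_plus (R : realType) (G : finZmodType) (A : {set G})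
    (f : G -> R) : Prop :=
  [/\ not_identically_zero f,
      forall x, x \notin A -> f x = 0 &
      forall x, x \in A -> 0 <= f x].

Definition class_S_pm (R : realType) (G : finZmodType) (A : {set G})
    (f : G -> R) : Prop :=
  [/\ not_identically_zero f,
      forall x, x \notin A -> f x <= 0 &
      forall x, x \in A -> 0 <= f x].

(* Functions whose Fourier transform vanishes at the principal character are  *)
(* excluded explicitly, since x / 0 = 0 would otherwise give them quotient 0. *)
Definition quotients (R : realType) (G : finZmodType)
    (C : (G -> R) -> Prop) (r : R) : Prop :=
  exists f : G -> R,
    [/\ C f, fourier_nonneg f,
        fourier f (principal_character R G) <> 0 &
        r%:C = (f 0)%:C / fourier f (principal_character R G)].

(* The least element of E; meaningful only when E has one (default value 0).  *)
Definition minimum (R : realType) (E : R -> Prop) : R :=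
  xget 0 (fun m => E m /\ forall r, E r -> m <= r).

Definition lambda (R : realType) (G : finZmodType) (A : {set G}) : R :=
  minimum (quotients (@class_S R G A)).

Definition lambda_minus (R : realType) (G : finZmodType) (A : {set G}) : R :=
  minimum (quotients (@class_S_minus R G A)).

Definition lambda_plus (R : realType) (G : finZmodType) (A : {set G}) : R :=
  minimum (quotients (@class_S_plus R G A)).

Definition lambda_pm (R : realType) (G : finZmodType) (A : {set G}) : R :=
  minimum (quotients (@class_S_pm R G A)).

(* Main.v *)
Require Import Defs.
From HB Require Import structures.
From mathcomp Require Import all_boot all_order all_algebra.
From mathcomp Require Import complex.
From mathcomp Require Import mathcomp_extra boolp classical_sets reals.
From mathcomp Require Import lra ring.

Set Implicit Arguments.
Unset Strict Implicit.
Unset Printing Implicit Defensive.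

Import Order.TTheory GRing.Theory Num.Theory.
Local Open Scope ring_scope.

(* By linear programming duality, each of the four minima for a set [A] is    *)
(* attained and equals [g^(1) / (q g(0))] for some [g] with nonnegative       *)
(* transform in the class dual to that of [A], i.e. with [f g <= 0] off [0]   *)
(* for all [f] in the class of [A].  Let [g1], [g2] be such functions for     *)
(* [A1], [A2] and let [f] attain the minimum for the union.  Then             *)
(* [f g1 g2 <= 0] off [0], while Parseval gives                               *)
(* [f^(1) g1^(1) g2^(1) <= q^2 \sum_x f g1 g2 <= q^2 f(0) g1(0) g2(0)],       *)
(* which is the product inequality.                                           *)

(** * Linear programming duality *)

(** Weak duality is the source of the lower bounds: if [h] lies in a class, [g] in its dual, and
    both have nonnegative transforms with positive sum, then h^(1) g^(1) <= q \sum_x h g <= q h(0)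
    g(0). [exists_dual_pair] supplies a pair with equality, by linear programming over combinations
    of characters. Products enter through [fourier_nonneg_mul]: nonnegativity of the transform
    survives multiplication. It remains to see that g1 g2 has the signs dual to the union. Away from
    0, dual functions vanish on A for lambda; vanish on A and are nonnegative elsewhere for
    lambda^-; are nonpositive on A for lambda^+; and are nonpositive on A, nonnegative outside, for
    lambda^pm. A second factor coming from lambda^- thus preserves the sign of the first and kills
    the product on A2. [minimum_quotients_mul] turns this sign check into the inequality. *)

Lemma exists_between (R : realFieldType) (K : finType) (P N : pred K)
    (lo up : K -> R) :
    (forall k l, P k -> N l -> lo k <= up l) ->
  exists z, (forall k, P k -> lo k <= z) /\ (forall l, N l -> z <= up l).
Proof.
move=> lo_up; case: (pickP P) => [k0 Pk0 | P0].
  case: (arg_maxP lo Pk0) => k Pk kmax.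
  by exists (lo k); split=> [j /kmax|l Nl] //; exact: lo_up.
case: (pickP N) => [l0 Nl0 | N0].
  case: (arg_minP up Nl0) => l Nl lmin.
  by exists (up l); split=> [k|j /lmin //]; rewrite P0.
by exists 0; split=> k; rewrite ?P0 ?N0.
Qed.

(* Fourier-Motzkin elimination, one variable of [s] at a time. *)
Lemma farkas_seq (R : realFieldType) (I : finType) (s : seq I) :
  uniq s -> forall (K : finType) (a : K -> I -> R) (b : K -> R),
  (exists x : I -> R, forall k, b k <= \sum_(i <- s) a k i * x i) \/
  (exists u : K -> R, [/\ forall k, 0 <= u k,
     {in s, forall i, \sum_k u k * a k i = 0} & 0 < \sum_k u k * b k]).
Proof.
elim: s => [_|i s IHs /= /andP[i_s uniq_s]] K a b.
  case: (pickP (fun k => 0 < b k)) => [k bk|b0].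
    right; exists (fun j => (j == k)%:R); split=> //.
    by rewrite (bigD1 k)//= eqxx mul1r big1 ?addr0// => j /negPf->;
      rewrite mul0r.
  by left; exists (fun=> 0) => k; rewrite big_nil leNgt b0.
(* Rows of [M] are the nonnegative combinations of constraints that cancel variable [i]: a
   constraint free of [i], or a pair with coefficients of opposite signs. All other indices give
   zero rows. *)
pose M (k' : K + K * K) (k : K) : R :=
  match k' with
  | inl l => if a l i == 0 then (k == l)%:R else 0
  | inr (l, m) => if (0 < a l i) && (a m i < 0) then
      (k == l)%:R * - a m i + (k == m)%:R * a l i else 0
  end.
have M_ge0 k' k : 0 <= M k' k.
  case: k' => [l|[l m]] /=; first by case: ifP.
  case: ifP => // /andP[al am].
  by rewrite addr_ge0// mulr_ge0// ?oppr_ge0 ltW.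
have sum_delta (F : K -> R) l : \sum_k (k == l)%:R * F k = F l.
  rewrite (bigD1 l)//= eqxx mul1r big1 ?addr0// => j /negPf->; exact: mul0r.
have M_l (F : K -> R) l : a l i = 0 -> \sum_k M (inl l) k * F k = F l.
  by move=> al0; rewrite /M al0 eqxx sum_delta.
have M_r (F : K -> R) l m : 0 < a l i -> a m i < 0 ->
    \sum_k M (inr (l, m)) k * F k = - a m i * F l + a l i * F m.
  move=> al am; rewrite /M al am /=.
  under eq_bigr do rewrite mulrDl -!mulrA.
  by rewrite big_split/= !sum_delta.
have M_i k' : \sum_k M k' k * a k i = 0.
  case: k' => [l|[l m]].
    have [al|al] := eqVneq (a l i) 0; first by rewrite M_l.
    by rewrite /M (negPf al) big1// => k _; rewrite mul0r.
  have [/andP[al am]|alm] := boolP ((0 < a l i) && (a m i < 0)).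
    by rewrite M_r//; lra.
  by rewrite /M (negPf alm) big1// => k _; rewrite mul0r.
have [[x xP]|[u [u_ge0 u_s u_b]]] := IHs uniq_s _
  (fun k' j => \sum_k M k' k * a k j) (fun k' => \sum_k M k' k * b k).
  left; pose S k := \sum_(j <- s) a k j * x j.
  have {}xP k' : \sum_k M k' k * b k <= \sum_k M k' k * S k.
    apply: le_trans (xP k') _; rewrite le_eqVlt; apply/orP; left; apply/eqP.
    under eq_bigr do rewrite mulr_suml.
    rewrite exchange_big/=; apply: eq_bigr => k _.
    by rewrite mulr_sumr; apply: eq_bigr => j _; rewrite mulrA.
  (* The paired rows of the reduced system say that every lower bound on the eliminated variable is
     at most every upper bound. *)
  have [z [zlo zup]] : exists z,
      (forall k, 0 < a k i -> (b k - S k) / a k i <= z) /\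
      (forall k, a k i < 0 -> z <= (b k - S k) / a k i).
    apply: exists_between => l m al am.
    rewrite ler_pdivrMr// mulrAC ler_ndivlMr//.
    by have := xP (inr (l, m)); rewrite !M_r//; lra.
  exists (fun j => if j == i then z else x j) => k.
  rewrite big_cons eqxx (eq_big_seq (fun j => a k j * x j)); last first.
    by move=> j js; case: eqP => // ji; rewrite -ji js in i_s.
  rewrite -/(S k); case: (ltgtP (a k i) 0) => [ak|ak|ak].
  - by have := zup _ ak; rewrite ler_ndivlMr//; lra.
  - by have := zlo _ ak; rewrite ler_pdivrMr//; lra.
  - by have := xP (inl k); rewrite !M_l// ak; lra.
right; exists (fun k => \sum_k' u k' * M k' k).
have sumM (F : K -> R) : \sum_k (\sum_k' u k' * M k' k) * F k =
    \sum_k' u k' * \sum_k M k' k * F k.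
  under eq_bigr do rewrite mulr_suml.
  rewrite exchange_big/=; apply: eq_bigr => k' _.
  by rewrite mulr_sumr; apply: eq_bigr => k _; rewrite mulrA.
split=> [k|j|]; last by rewrite sumM.
  by apply: sumr_ge0 => k' _; rewrite mulr_ge0.
rewrite inE sumM => /orP[/eqP->|js]; last exact: u_s.
by apply: big1 => k' _; rewrite M_i mulr0.
Qed.

Lemma farkas (R : realFieldType) (I K : finType) (a : K -> I -> R) (b : K -> R) :
  (exists x : I -> R, forall k, b k <= \sum_i a k i * x i) \/
  (exists u : K -> R, [/\ forall k, 0 <= u k,
     forall i, \sum_k u k * a k i = 0 & 0 < \sum_k u k * b k]).
Proof.
have [xP|[u [? u_i ?]]] := farkas_seq (index_enum_uniq I) a b; [by left|right].
by exists u; split=> // i; apply: u_i; rewrite mem_index_enum.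
Qed.

(* Farkas' lemma applied to the conjunction of primal feasibility, dual       *)
(* feasibility and the reverse of weak duality.                               *)
Lemma linear_programming_duality (R : realFieldType) (I K : finType)
    (a : K -> I -> R) (b : K -> R) (c x0 : I -> R) (u0 : K -> R) :
    (forall k, b k <= \sum_i a k i * x0 i) ->
    (forall k, 0 <= u0 k) -> (forall i, \sum_k u0 k * a k i = c i) ->
  exists (x : I -> R) (u : K -> R),
    [/\ forall k, b k <= \sum_i a k i * x i, forall k, 0 <= u k,
        forall i, \sum_k u k * a k i = c i &
        \sum_i c i * x i <= \sum_k u k * b k].
Proof.
move=> x0P u0_ge0 u0P.
(* Unknowns are the pair (x, u). The row blocks are primal feasibility, [u >= 0], the two halves of
   the dual equality, and the reverse of weak duality. *)
pose A (r : K + (K + (I + (I + unit)))) (v : I + K) : R :=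
  match r, v with
  | inl k, inl i => a k i
  | inr (inl k), inr l => (l == k)%:R
  | inr (inr (inl i)), inr k => a k i
  | inr (inr (inr (inl i))), inr k => - a k i
  | inr (inr (inr (inr _))), inl i => - c i
  | inr (inr (inr (inr _))), inr k => b k
  | _, _ => 0
  end.
pose B (r : K + (K + (I + (I + unit)))) : R :=
  match r with
  | inl k => b k
  | inr (inr (inl i)) => c i
  | inr (inr (inr (inl i))) => - c i
  | _ => 0
  end.
have [[y yP]|[w [w_ge0 wA wB]]] := farkas A B.
  exists (fun i => y (inl i)), (fun k => y (inr k)); split.
  - move=> k; have := yP (inl k); rewrite big_sumType/= [X in _ + X]big1 ?addr0//.
    by move=> j _; rewrite mul0r.
  - move=> k; have := yP (inr (inl k)); rewrite big_sumType/= big1 ?add0r//.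
      rewrite (bigD1 k)//= eqxx mul1r big1 ?addr0// => j /negPf->.
      exact: mul0r.
    by move=> j _; rewrite mul0r.
  - move=> i; apply/eqP; rewrite eq_le.
    have := yP (inr (inr (inl i))); have := yP (inr (inr (inr (inl i)))).
    rewrite !big_sumType/= !(big1 _ _ (fun j => 0 * y (inl j))) ?add0r;
      try by move=> j _; rewrite mul0r.
    under eq_bigr do rewrite mulNr.
    rewrite sumrN lerN2 => le1 le2.
    by under eq_bigr do rewrite mulrC; rewrite le1.
  - have := yP (inr (inr (inr (inr tt)))); rewrite big_sumType/=.
    under eq_bigr do rewrite mulNr.
    rewrite sumrN addrC subr_ge0 => /le_trans; apply.
    by under eq_bigr do rewrite mulrC.
(* An infeasibility certificate amounts to solutions of the problems homogenized by [t]: [l a = t c]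
   and [a z >= t b] with [l >= 0], yet [c z < l b]. *)
pose l k := w (inl k); pose m k := w (inr (inl k)).
pose z i := w (inr (inr (inr (inl i)))) - w (inr (inr (inl i))).
pose t := w (inr (inr (inr (inr tt)))).
have sumE (F : K + (K + (I + (I + unit))) -> R) : \sum_r F r =
    \sum_k F (inl k) + (\sum_k F (inr (inl k)) +
      (\sum_i F (inr (inr (inl i))) + (\sum_i F (inr (inr (inr (inl i)))) +
        F (inr (inr (inr (inr tt))))))).
  by rewrite !big_sumType/= (big_pred1 tt)// => -[].
have sum0 (J : finType) (F : J -> R) : \sum_j F j * 0 = 0.
  by apply: big1 => j _; rewrite mulr0.
have sumN (J : finType) (F H : J -> R) : \sum_j F j * - H j = - \sum_j F j * H j.
  by rewrite -sumrN; apply: eq_bigr => j _; rewrite mulrN.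
have sumC (J : finType) (F H : J -> R) : \sum_j F j * H j = \sum_j H j * F j.
  by apply: eq_bigr => j _; rewrite mulrC.
have lP i : \sum_k l k * a k i = t * c i.
  by have := wA (inl i); rewrite sumE/= !sum0 -/t; rewrite /l; lra.
have zP k : \sum_i a k i * z i = m k + t * b k.
  have := wA (inr k); rewrite sumE/= !sum0 -/t.
  rewrite (bigD1 k)//= eqxx mulr1 big1 ?addr0; last first.
    by move=> j; rewrite eq_sym => /negPf->; rewrite mulr0.
  rewrite sumN -/(m k) (sumC _ (a k)) /z.
  under [X in _ -> X = _]eq_bigr do rewrite mulrBl.
  by rewrite sumrB; lra.
have {}wB : \sum_i c i * z i < \sum_k l k * b k.
  move: wB; rewrite sumE/= !sum0 mulr0 sumN (sumC _ c) /z.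
  under [X in _ -> X < _]eq_bigr do rewrite mulrBl.
  by rewrite sumrB /l; lra.
have t_ge0 : 0 <= t by exact: w_ge0.
have swap (v : K -> R) (x : I -> R) : \sum_k v k * (\sum_i a k i * x i) =
    \sum_i (\sum_k v k * a k i) * x i.
  under eq_bigr do rewrite mulr_sumr.
  rewrite exchange_big/=; apply: eq_bigr => i _.
  by rewrite mulr_suml; apply: eq_bigr => k _; rewrite mulrA.
have lz := swap l z; have lx := swap l x0; have uz := swap u0 z.
have le_lb : t * \sum_k l k * b k <= t * \sum_i c i * z i.
  rewrite [X in _ <= X]mulr_sumr; under [X in _ <= X]eq_bigr do rewrite mulrA -lP.
  rewrite -lz mulr_sumr; apply: ler_sum => k _.
  by rewrite mulrCA ler_wpM2l ?w_ge0// zP lerDr w_ge0.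
(* For [t > 0], [le_lb] is weak duality for [z / t] and [l / t], against [wB]. For [t = 0], pairing
   [l] with [x0] and [z] with [u0] gives [l b <= 0 <= c z]. *)
have [t0|t_neq0] := eqVneq t 0; last first.
  by move: le_lb; rewrite ler_pM2l ?lt_def ?t_neq0// leNgt wB.
have : \sum_k l k * b k <= 0.
  apply: (@le_trans _ _ (\sum_k l k * \sum_i a k i * x0 i)).
    by apply: ler_sum => k _; rewrite ler_wpM2l ?w_ge0.
  by rewrite lx big1// => i _; rewrite lP t0 !mul0r.
have : 0 <= \sum_i c i * z i.
  under eq_bigr do rewrite -u0P.
  rewrite -uz; apply: sumr_ge0 => k _.
  by rewrite mulr_ge0// zP t0 mul0r addr0 w_ge0.
by move: wB; lra.
Qed.

(** * Characters and Fourier positivity *)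

Section Characters.
Variables (R : realType) (G : finZmodType).
Local Open Scope complex_scope.
Implicit Types (gamma delta : G -> R[i]).
Local Notation q := (#|G|%:R : R[i]).

Lemma card_group_gt0 : (0 < #|G|)%N.
Proof. by apply/card_gt0P; exists 0. Qed.

Lemma card_group_neq0 : q != 0.
Proof. by rewrite pnatr_eq0 -lt0n card_group_gt0. Qed.

Lemma mul_conjc_norm1 (z : R[i]) : `|z| = 1 -> z * z^* = 1.
Proof. by move=> z1; rewrite -sqr_normc z1 expr1n. Qed.

Lemma character_neq0 gamma x : is_character gamma -> gamma x != 0.
Proof. by case=> _ gamma1; rewrite -normr_eq0 gamma1 oner_eq0. Qed.

Lemma character0 gamma : is_character gamma -> gamma 0 = 1.
Proof.
move=> gammaP; have g0 := character_neq0 0 gammaP.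
by apply: (mulfI g0); rewrite -gammaP.1 addr0 mulr1.
Qed.

Lemma characterN gamma x : is_character gamma -> gamma (- x) = (gamma x)^*.
Proof.
move=> gammaP; apply: (mulfI (character_neq0 x gammaP)).
by rewrite -gammaP.1 subrr character0// mul_conjc_norm1//; exact: gammaP.2.
Qed.

Lemma character_mul gamma delta : is_character gamma -> is_character delta ->
  is_character (fun x => gamma x * delta x).
Proof.
move=> [gammaD gamma1] [deltaD delta1]; split=> [x y|x].
  by rewrite gammaD deltaD mulrACA.
by rewrite normrM gamma1 delta1 mulr1.
Qed.

Lemma character_conj gamma : is_character gamma ->
  is_character (fun x => (gamma x)^*).
Proof.
move=> [gammaD gamma1]; split=> [x y|x]; first by rewrite gammaD rmorphM.
by rewrite normcJ.
Qed.

Lemma principal_is_character : is_character (principal_character R G).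
Proof. by split=> *; rewrite /principal_character ?mulr1 ?normr1. Qed.

(* Translating the summation variable multiplies the sum by [gamma a]. *)
Lemma sum_character_eq0 gamma a : is_character gamma -> gamma a != 1 ->
  \sum_x gamma x = 0.
Proof.
move=> gammaP ga; apply/eqP.
have : gamma a * \sum_x gamma x == \sum_x gamma x.
  rewrite [X in _ == X](reindex_inj (addrI a))/= mulr_sumr.
  by apply/eqP/eq_bigr => x _; rewrite gammaP.1.
rewrite -subr_eq0 -[X in _ - X]mul1r -mulrBl mulf_eq0 subr_eq0.
by rewrite (negPf ga).
Qed.

Lemma sum_character gamma : is_character gamma ->
  gamma =1 (fun=> 1) \/ \sum_x gamma x = 0.
Proof.
move=> gammaP; case: (pickP (fun a => gamma a != 1)) => [a ga|g1].
  by right; exact: sum_character_eq0 ga.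
by left => x; apply/eqP/negbFE; rewrite g1.
Qed.

Lemma sum_character_ge0 gamma : is_character gamma -> 0 <= \sum_x gamma x.
Proof.
move=> /sum_character[g1|->//].
by apply: sumr_ge0 => x _; rewrite g1 ler01.
Qed.

(** * Characters as common eigenvectors of the translations *)

Definition translation_mx (a : G) : 'M[R[i]]_#|G| :=
  \matrix_(k, j) (enum_val k == enum_val j + a)%:R.

Lemma sum_enum_val (F : G -> R[i]) :
  \sum_(j < #|G|) F (enum_val j) = \sum_x F x.
Proof. by rewrite [RHS](reindex _ (onW_bij _ (enum_val_bij G))). Qed.

Lemma translation_mxM a b :
  translation_mx a *m translation_mx b = translation_mx (a + b).
Proof.
apply/matrixP => k j; rewrite !mxE.
under eq_bigr do rewrite !mxE.
rewrite (sum_enum_val (fun x => (enum_val k == x + a)%:R *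
  (x == enum_val j + b)%:R)) (bigD1 (enum_val j + b))//= eqxx mulr1.
rewrite big1 ?addr0 => [|x /negPf->]; last by rewrite mulr0.
by rewrite -addrA [b + a]addrC.
Qed.

Lemma translation_mx_comm a b :
  comm_mx (translation_mx a) (translation_mx b).
Proof. by rewrite /comm_mx !translation_mxM addrC. Qed.

Lemma translation_mx_diagonalizable a :
  exists2 P : 'M_#|G|, P \in unitmx &
    mxpoly.diagonalizable_for P (translation_mx a).
Proof.
have adj : map_mx Num.conj (translation_mx a)^T = translation_mx (- a).
  apply/matrixP => k j; rewrite !mxE rmorph_nat; congr (_ %:R).
  by rewrite -subr_eq eq_sym.
have /orthomx_spectralP ED : translation_mx a \is normalmx.
  by apply/normalmxP; rewrite adj; exact: translation_mx_comm.
exists (spectralmx (translation_mx a)); first exact: spectral_unit.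
apply/mxpoly.diagonalizable_forPex; exists (spectral_diag (translation_mx a)).
apply/mxpoly.simmxP; first exact: spectral_unit.
by rewrite [X in _ *m X]ED !mulmxA mulmxV ?spectral_unit// mul1mx.
Qed.

(* The translations commute and are normal, hence have a common eigenbasis;   *)
(* an eigenvector of all the translations is a multiple of a character.       *)
Lemma exists_character_basis : exists chi : 'I_#|G| -> G -> R[i],
  (forall i, is_character (chi i)) /\
  (forall x y, \sum_i (chi i x)^* * chi i y = q * (x == y)%:R).
Proof.
have [P Punit /allP/= Pdiag] : exists2 P : 'M_#|G|, P \in unitmx &
    all [pred A | mxpoly.diagonalizable_for P A]
      [seq translation_mx a | a <- enum G].
  apply/mxpoly.codiagonalizableP; split.
    by move=> _ _ /mapP[a _ ->] /mapP[b _ ->]; exact: translation_mx_comm.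
  by move=> _ /mapP[a _ ->]; exact: translation_mx_diagonalizable.
pose v i x := P i (enum_rank x).
(* Row [i] of [P] is a left eigenvector of every translation, and multiplying by [translation_mx a]
   on the right shifts its entries by [a]. *)
have shift i a : exists d, forall x, v i (x + a) = d * v i x.
  have /mxpoly.diagonalizable_forPex[D /(mxpoly.simmxP Punit) PD] :=
    Pdiag _ (map_f translation_mx (mem_enum G a)).
  exists (D 0 i) => x; have /matrixP/(_ i (enum_rank x)) := PD.
  rewrite mul_diag_mx !mxE => <-.
  under eq_bigr do rewrite mxE enum_rankK.
  rewrite (bigD1 (enum_rank (x + a)))//= enum_rankK eqxx mulr1 big1 ?addr0//.
  by move=> k; rewrite -(can_eq enum_valK) enum_rankK => /negPf->; rewrite mulr0.
have v0 i : v i 0 != 0.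
  apply/eqP => vi0; have : row i P = 0.
    apply/rowP => j; rewrite !mxE -[j]enum_valK -/(v i _) -[enum_val j]add0r.
    by have [d ->] := shift i (enum_val j); rewrite vi0 mulr0.
  move/(congr1 (mulmx^~ (invmx P))); rewrite -row_mul mulmxV// mul0mx.
  move=> /rowP/(_ i); rewrite !mxE eqxx => /eqP.
  by rewrite oner_eq0.
pose chi i x := v i x / v i 0.
have chiP i x a : v i (x + a) = chi i a * v i x.
  have [d dE] := shift i a; rewrite /chi -[in v i a](add0r a) !dE.
  by rewrite mulfK.
have chi_neq0 i x : v i x != 0.
  apply/eqP => vx; have /eqP := v0 i; rewrite -(subrr x) chiP vx mulr0.
  by [].
have chi_char i : is_character (chi i).
  split=> [x y|a].
    by apply: (mulIf (v0 i)); rewrite -[RHS]mulrA [RHS]mulrCA -!chiP !add0r chiP.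
  (* The product of all entries is translation invariant and nonzero, so [chi i a] is a root of
     unity and has modulus 1. *)
  have : \prod_x v i x = \prod_x v i (x + a) by exact: reindex_inj (addIr a).
  under [RHS]eq_bigr do rewrite chiP.
  rewrite big_split/= prodr_const -[LHS]mul1r => /mulIf H.
  apply/eqP; rewrite -(@pexpr_eq1 _ _ #|G|) ?card_group_gt0// -normrX.
  rewrite -H ?normr1//; apply/prodf_neq0 => x _; exact: chi_neq0.
have chi_inj i j : chi i =1 chi j -> i = j.
  move=> chiE.
  (* Equal characters would make two rows of the invertible matrix [P] proportional. *)
  have : (v j 0 *: delta_mx 0 i : 'rV_#|G|) = v i 0 *: delta_mx 0 j.
    apply: (row_free_inj (A := P)); first by rewrite row_free_unit.
    rewrite -!scalemxAl -!rowE; apply/rowP => k; rewrite !mxE -[k]enum_valK.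
    rewrite -/(v i _) -/(v j _) -[enum_val k]add0r !chiP chiE.
    by rewrite mulrCA [in RHS]mulrCA [v i 0 * _]mulrC.
  move=> /rowP/(_ i); rewrite !mxE !eqxx mulr1; case: eqP => // _ /eqP.
  by rewrite mulr0 (negPf (v0 j)).
exists chi; split=> // x y.
pose Q : 'M[R[i]]_#|G| := \matrix_(i, k) chi i (enum_val k).
pose Q' : 'M[R[i]]_#|G| := \matrix_(k, i) ((chi i (enum_val k))^* / q).
(* Orthogonality of distinct characters gives [Q Q' = 1]; the claim is the entrywise form of
   [Q' Q = 1]. *)
have /mulmx1C/matrixP/(_ (enum_rank x) (enum_rank y)) : Q *m Q' = 1%:M.
  apply/matrixP => i j; rewrite !mxE.
  under eq_bigr do rewrite !mxE mulrA.
  rewrite -mulr_suml (sum_enum_val (fun x => chi i x * (chi j x)^*)).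
  have [<-|ij] := eqVneq i j.
    under eq_bigr do rewrite mul_conjc_norm1 ?(chi_char i).2//.
    by rewrite sumr_const divff ?card_group_neq0.
  have [|->] := sum_character (character_mul (chi_char i)
    (character_conj (chi_char j))); last by rewrite mul0r.
  move=> chi_ij; case/eqP: ij; apply: chi_inj => z.
  apply: (mulIf (character_neq0 z (character_conj (chi_char j)))).
  by rewrite chi_ij mul_conjc_norm1// (chi_char j).2.
rewrite !mxE (can_eq (@enum_rankK G)) => <-.
rewrite mulr_sumr; apply: eq_bigr => i _.
rewrite !mxE !enum_rankK.
by rewrite [RHS]mulrA [q * _]mulrCA divff ?mulr1 ?card_group_neq0.
Qed.

Section FourierPositivity.
Variable chi : 'I_#|G| -> G -> R[i].
Hypothesis chi_char : forall i, is_character (chi i).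
Hypothesis chi_basis :
  forall x y, \sum_i (chi i x)^* * chi i y = q * (x == y)%:R.

(** A nonzero inner product with [chi i] forces equality. Not all can vanish, since by [chi_basis]
    their sum over [i] is q gamma(0). *)
Lemma character_in_basis gamma : is_character gamma -> exists i, chi i =1 gamma.
Proof.
move=> gammaP.
case: (pickP (fun i => \sum_x gamma x * (chi i x)^* != 0)) => [i|sum0].
  have [gc|->] := sum_character (character_mul gammaP
    (character_conj (chi_char i))); last by rewrite eqxx.
  move=> _; exists i => x.
  apply: (mulIf (character_neq0 x (character_conj (chi_char i)))).
  by rewrite gc mul_conjc_norm1// (chi_char i).2.
have /eqP : \sum_i \sum_x gamma x * (chi i x)^* = 0.
  by apply: big1 => i _; apply/eqP/negbFE; rewrite sum0.
rewrite exchange_big/= (bigD1 0)//= [X in _ + X]big1 ?addr0 => [|x x0].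
  under eq_bigr do rewrite (character0 (chi_char _)) rmorph1 mulr1.
  by rewrite sumr_const card_ord mulrn_eq0 (negPf (character_neq0 0 gammaP))
    orbF -leqn0 leqNgt card_group_gt0.
rewrite -mulr_sumr (eq_bigr (fun i => (chi i x)^* * chi i 0)).
  by rewrite chi_basis (negPf x0) !mulr0.
by move=> i _; rewrite character0 ?mulr1.
Qed.

Lemma parseval (a b : G -> R[i]) : q * \sum_x a x * b x =
  \sum_i (\sum_x a x * chi i x) * (\sum_x b x * (chi i x)^*).
Proof.
under [RHS]eq_bigr do rewrite big_distrlr/=.
rewrite exchange_big/= mulr_sumr; apply: eq_bigr => x _.
rewrite exchange_big/= (bigD1 x)//= [X in _ = _ + X]big1 ?addr0 => [|y yx].
  under eq_bigr do rewrite mulrACA [chi _ _ * _]mulrC.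
  by rewrite -mulr_sumr chi_basis eqxx mulr1 mulrC.
under eq_bigr do rewrite mulrACA [chi _ _ * _]mulrC.
by rewrite -mulr_sumr chi_basis (negPf yx) !mulr0.
Qed.

End FourierPositivity.

(** * Inequalities for functions with nonnegative transform *)

Lemma fourier_principal (f : G -> R) :
  fourier f (principal_character R G) = (\sum_x f x)%:C.
Proof. by rewrite rmorph_sum; apply: eq_bigr => x _; rewrite mul1r. Qed.

Lemma fourier_nonneg_sum_ge0 (f : G -> R) : fourier_nonneg f -> 0 <= \sum_x f x.
Proof.
by move=> /(_ _ principal_is_character); rewrite fourier_principal ler0c.
Qed.

(* The Fourier transform of a product is the normalized convolution of the    *)
(* transforms; at the principal character, keep only the principal term.      *)
Lemma fourier_nonneg_mul (f g : G -> R) :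
    fourier_nonneg f -> fourier_nonneg g ->
  fourier_nonneg (fun x => f x * g x) /\
  (\sum_x f x) * (\sum_x g x) <= #|G|%:R * \sum_x f x * g x.
Proof.
move=> f_ge0 g_ge0; have [chi [chi_char chi_basis]] := exists_character_basis.
have conv gamma : q * fourier (fun x => f x * g x) gamma =
    \sum_i fourier f (fun x => gamma x * chi i x) *
      fourier g (fun x => (chi i x)^*).
  rewrite /fourier; under eq_bigr do rewrite rmorphM/= mulrA.
  rewrite (parseval chi_basis); apply: eq_bigr => i _; congr (_ * _).
    by apply: eq_bigr => x _; rewrite mulrAC.
  by apply: eq_bigr => x _; rewrite mulrC.
have term_ge0 gamma i : is_character gamma ->
    0 <= fourier f (fun x => gamma x * chi i x) *
      fourier g (fun x => (chi i x)^*).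
  move=> gammaP; apply: mulr_ge0.
    exact/f_ge0/character_mul.
  exact/g_ge0/character_conj.
split=> [gamma gammaP|].
  rewrite -(@pmulr_rge0 _ q) ?lt_def ?card_group_neq0 ?ler0n//.
  by rewrite conv; apply: sumr_ge0 => i _; exact: term_ge0.
have [i0 chi0] := character_in_basis chi_char chi_basis principal_is_character.
rewrite -lecR !rmorphM/= rmorph_nat -!fourier_principal conv (bigD1 i0)//=.
rewrite -[X in X <= _]addr0; apply: lerD.
  rewrite le_eqVlt; apply/orP; left; apply/eqP; congr (_ * _).
    by apply: eq_bigr => x _; rewrite chi0 mulr1.
  by apply: eq_bigr => x _; rewrite chi0 rmorph1.
by apply: sumr_ge0 => i _; apply: term_ge0; exact: principal_is_character.
Qed.

(** This is the product inequality with the second factor the indicator of 0, whose transform is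
    identically 1. *)
Lemma fourier_nonneg_sum_le (f : G -> R) :
  fourier_nonneg f -> \sum_x f x <= #|G|%:R * f 0.
Proof.
move=> f_ge0.
have delta_ge0 : fourier_nonneg (fun x : G => (x == 0)%:R : R).
  move=> gamma gammaP; rewrite /fourier (bigD1 0)//= eqxx mulr1 big1 ?addr0.
    by rewrite character0// ler01.
  by move=> x /negPf->; rewrite mulr0.
have [_] := fourier_nonneg_mul f_ge0 delta_ge0.
have -> : \sum_(x : G) (x == 0)%:R = 1 :> R.
  by rewrite (bigD1 0)//= eqxx big1 ?addr0// => x /negPf->.
rewrite mulr1 [X in _ <= _ * X](bigD1 0)//= eqxx mulr1.
by rewrite [X in _ + X]big1 ?addr0// => x /negPf->; rewrite mulr0.
Qed.

Lemma fourier_nonneg_at0_gt0 (f : G -> R) :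
  fourier_nonneg f -> 0 < \sum_x f x -> 0 < f 0.
Proof.
move=> /fourier_nonneg_sum_le fle f_gt0.
have := lt_le_trans f_gt0 fle; rewrite pmulr_rgt0// ltr0n.
exact: card_group_gt0.
Qed.

End Characters.

(** * Duality for the extremal problems *)

Section DualPair.
Variables (R : realType) (G : finZmodType).
Local Open Scope complex_scope.

Definition sign_class (P N : pred G) (f : G -> R) : Prop :=
  (forall x, P x -> 0 <= f x) /\ (forall x, N x -> f x <= 0).

(* The functions [g] for which [f * g <= 0] off [0] whenever [f] is in        *)
(* [sign_class P N].                                                          *)
Definition dual_sign_class (P N : pred G) : (G -> R) -> Prop :=
  sign_class [pred x | ~~ P x & x != 0] [pred x | ~~ N x & x != 0].

(* A function with nonnegative transform is a nonnegative combination of the  *)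
(* [Re (chi i)], so minimizing [f 0] under the constraint [1 <= c i0] on the  *)
(* principal coefficient is a linear program in the coefficients [c]; its     *)
(* dual solution is symmetrized to give [g].                                  *)
Lemma exists_dual_pair (P N : pred G) :
    (forall x, P (- x) = P x) -> (forall x, N (- x) = N x) ->
    ~~ P 0 -> ~~ N 0 ->
  exists f g : G -> R,
    [/\ [/\ fourier_nonneg f, 0 < \sum_x f x & sign_class P N f],
        [/\ fourier_nonneg g, 0 < \sum_x g x & dual_sign_class P N g] &
        #|G|%:R * f 0 * g 0 <= (\sum_x f x) * (\sum_x g x)].
Proof.
move=> symP symN /negPf P0 /negPf N0.
have [chi [chi_char chi_basis]] := exists_character_basis R G.
have [i0 chi0] := character_in_basis chi_char chi_basis
  (principal_is_character R G).
pose w i x : R := complex.Re (chi i x).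
have w_0 i : w i 0 = 1 by rewrite /w character0.
have w_i0 x : w i0 x = 1 by rewrite /w chi0.
have wE i x : (w i x)%:C = (chi i x + (chi i x)^*) / 2 by rewrite ReJ_add.
have fourier_w_ge0 i : fourier_nonneg (w i).
  move=> gamma gammaP; rewrite /fourier.
  under eq_bigr do rewrite wE mulrA mulrDr.
  rewrite -mulr_suml big_split/= divr_ge0// addr_ge0//.
    exact/sum_character_ge0/character_mul.
  exact/sum_character_ge0/character_mul/character_conj.
have sum_w x : x != 0 -> \sum_i w i x = 0.
  move=> x0; apply: complexI; rewrite rmorph_sum/=.
  have sum_chi : \sum_i chi i x = 0.
    rewrite (eq_bigr (fun i => (chi i 0)^* * chi i x)).
      by rewrite chi_basis eq_sym (negPf x0) mulr0.
    by move=> i _; rewrite character0 ?rmorph1 ?mul1r.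
  under eq_bigr do rewrite wE.
  by rewrite -mulr_suml big_split/= -rmorph_sum/= sum_chi rmorph0 addr0 mul0r.
pose a (k : 'I_#|G| + (unit + (G + G))) (j : 'I_#|G|) : R :=
  match k with
  | inl i => (i == j)%:R
  | inr (inl _) => (i0 == j)%:R
  | inr (inr (inl x)) => (P x)%:R * w j x
  | inr (inr (inr x)) => (N x)%:R * - w j x
  end.
pose b (k : 'I_#|G| + (unit + (G + G))) : R := if k is inr (inl _) then 1 else 0.
pose u0 (k : 'I_#|G| + (unit + (G + G))) : R := if k is inl _ then 1 else 0.
have sumE (F : 'I_#|G| + (unit + (G + G)) -> R) : \sum_k F k =
    \sum_i F (inl i) + (F (inr (inl tt)) +
      (\sum_x F (inr (inr (inl x))) + \sum_x F (inr (inr (inr x))))).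
  by rewrite !big_sumType/= (big_pred1 tt)// => -[].
have sum_delta (F : 'I_#|G| -> R) i : \sum_j (i == j)%:R * F j = F i.
  rewrite (bigD1 i)//= eqxx mul1r big1 ?addr0// => j.
  by rewrite eq_sym => /negPf->; rewrite mul0r.
(* All coefficients 1 are primal feasible: the sum of all characters vanishes off 0, where the sign
   constraints live. The dual point [u0] puts all weight on the constraints [c i >= 0]. *)
have [] := @linear_programming_duality R _ _ a b (fun=> 1) (fun=> 1) u0.
- move=> [i|[[]|[x|x]]]; rewrite /b /a ?(sum_delta (fun=> 1)) ?ler01//.
    under eq_bigr do rewrite mulr1.
    rewrite -mulr_sumr; have [Px|_] := boolP (P x); last by rewrite mul0r.
    by rewrite sum_w ?mulr0//; apply: contraTneq Px => ->; rewrite P0.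
  under eq_bigr do rewrite mulr1.
  rewrite -mulr_sumr sumrN; have [Nx|_] := boolP (N x); last by rewrite mul0r.
  by rewrite sum_w ?oppr0 ?mulr0//; apply: contraTneq Nx => ->; rewrite N0.
- by case.
- move=> i; rewrite sumE/= !mul0r !(big1 _ _ (fun x => 0 * _)) ?addr0;
    try by move=> *; rewrite mul0r.
  under eq_bigr do rewrite mul1r eq_sym -[_%:R]mulr1.
  by rewrite sum_delta.
move=> c [u [cP u_ge0 uP cu]].
have c_ge0 i : 0 <= c i.
  by have := cP (inl i); rewrite /a /b sum_delta.
have ci0 : 1 <= c i0.
  by have := cP (inr (inl tt)); rewrite /a /b sum_delta.
pose t := u (inr (inl tt)).
have {}cu : \sum_i c i <= t.
  move: cu; rewrite sumE/= !(big1 _ _ (fun x => _ * 0)) ?addr0 ?add0r ?mulr1//;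
    try by move=> *; rewrite mulr0.
  by under eq_bigr do rewrite mul1r.
have t_gt0 : 0 < t.
  apply: lt_le_trans ltr01 (le_trans ci0 (le_trans _ cu)).
  by rewrite (bigD1 i0)//= lerDl sumr_ge0.
pose f x := \sum_i c i * w i x.
(* The multipliers of the sign constraints, with value 1 at 0. Dual feasibility becomes [h_w]:
   pairing [h] with [w i] gives a nonnegative number, and at least [t] for [i0]. *)
pose h x := (x == 0)%:R - u (inr (inr (inl x))) * (P x)%:R +
  u (inr (inr (inr x))) * (N x)%:R.
have h_w i : \sum_x h x * w i x = u (inl i) + t * (i0 == i)%:R.
  have := uP i; rewrite sumE/= -/t.
  under eq_bigr do rewrite mulrC eq_sym.
  rewrite sum_delta.
  under [X in _ -> X = _]eq_bigr do rewrite mulrDl mulrBl.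
  rewrite big_split/= sumrB (bigD1 (F := fun x => (x == 0)%:R * _) 0)//=.
  rewrite eqxx w_0 mul1r [X in 1 + X]big1 ?addr0; last first.
    by move=> x /negPf->; rewrite mul0r.
  under eq_bigr do rewrite mulrA.
  under [X in _ + (_ + (_ + X)) = _ -> _]eq_bigr do rewrite mulrA mulrN.
  by rewrite sumrN; lra.
have f0 : f 0 = \sum_i c i.
  by apply: eq_bigr => i _; rewrite w_0 mulr1.
have sum_f : #|G|%:R <= \sum_x f x.
  rewrite /f exchange_big/= (bigD1 i0)//=.
  under eq_bigr do rewrite w_i0 mulr1.
  rewrite sumr_const -[X in X <= _]addr0 lerD//.
    by rewrite lerMn2r ci0 orbT.
  apply: sumr_ge0 => i _; rewrite -mulr_sumr mulr_ge0//.
  exact: fourier_nonneg_sum_ge0.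
have sum_hN : \sum_x h (- x) = \sum_x h x.
  by rewrite [RHS](reindex_inj (@oppr_inj _)).
have sum_h : t <= \sum_x h x.
  have := h_w i0; under eq_bigr do rewrite w_i0 mulr1.
  by rewrite eqxx mulr1 => ->; rewrite lerDr.
have card_gt0 : 0 < #|G|%:R :> R by rewrite ltr0n card_group_gt0.
(* Adding the reflection makes the transform real, equal to twice the pairing of [h] with the real
   part of the character. *)
exists f, (fun x => h x + h (- x)); rewrite big_split/= sum_hN; split.
- split; first 2 last.
  + split=> x Hx.
      have := cP (inr (inr (inl x))); rewrite /a /b Hx => /le_trans; apply.
      by rewrite le_eqVlt; apply/orP; left; apply/eqP/eq_bigr => i _;
        rewrite mul1r mulrC.
    have := cP (inr (inr (inr x))); rewrite /a /b Hx -oppr_le0 => fN.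
    apply: le_trans fN; rewrite -sumrN le_eqVlt; apply/orP; left.
    by apply/eqP/eq_bigr => i _; rewrite mul1r mulNr opprK mulrC.
  + move=> gamma gammaP; rewrite /fourier /f.
    under eq_bigr do rewrite rmorph_sum mulr_sumr.
    rewrite exchange_big/=; apply: sumr_ge0 => i _.
    under eq_bigr do rewrite rmorphM/= mulrCA.
    by rewrite -mulr_sumr mulr_ge0 ?ler0c//; exact: fourier_w_ge0.
  + exact: lt_le_trans sum_f.
- split; last 1 first.
  + split=> x /= /andP[/negPf Hx /negPf x0]; rewrite /h oppr_eq0 x0 symP symN Hx.
      by rewrite !mulr0 !subr0 !add0r addr_ge0// mulr_ge0.
    by rewrite !mulr0 !addr0 !sub0r -opprD oppr_le0 addr_ge0// mulr_ge0.
  + move=> gamma gammaP.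
    have [i chi_i] := character_in_basis chi_char chi_basis gammaP.
    suff -> : fourier (fun x => h x + h (- x)) gamma =
        (2 * \sum_x h x * w i x)%:C.
      by rewrite ler0c mulr_ge0// h_w addr_ge0// mulr_ge0// ltW.
    rewrite rmorphM rmorph_sum/= mulr_sumr /fourier.
    under eq_bigr do rewrite rmorphD mulrDr.
    rewrite big_split/= [X in _ + X](reindex_inj (@oppr_inj _))/= -big_split/=.
    apply: eq_bigr => x _; rewrite opprK characterN// -mulrDl addcJ rmorphM/=.
    by rewrite /w chi_i rmorph_nat [in RHS]mulrCA [in RHS]mulrC.
  + by apply: addr_gt0; exact: lt_le_trans sum_h.
rewrite f0 oppr0 {1 2}/h eqxx P0 N0 !mulr0 subr0 addr0.
apply: (@le_trans _ _ (#|G|%:R * (t + t))).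
  by rewrite -mulrA ler_pM2l// mulrDr mulr1 lerD.
by rewrite ler_pM// ?lerD// ?addr_ge0// ltW.
Qed.
End DualPair.

(** * Attainment of the minima and the product inequality *)

Section MinimumQuotients.
Variables (R : realType) (G : finZmodType).
Local Open Scope complex_scope.
Implicit Types (P N : pred G) (C : (G -> R) -> Prop) (A : {set G}).

Lemma minimumE (E : R -> Prop) m :
  E m -> (forall r, E r -> m <= r) -> minimum E = m.
Proof.
move=> Em m_le; rewrite /minimum; case: xgetP => [y _ [Ey y_le]|/(_ m)[]//].
by apply/eqP; rewrite eq_le y_le// m_le.
Qed.

Lemma quotientsP C r : quotients C r <-> exists f : G -> R,
  [/\ C f, fourier_nonneg f, 0 < \sum_x f x & r = f 0 / \sum_x f x].
Proof.
split=> -[f [Cf f_ge0 sum_f rE]]; exists f; split=> //.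
- rewrite lt_def fourier_nonneg_sum_ge0// andbT; apply/eqP => f0.
  by apply: sum_f; rewrite fourier_principal f0 rmorph0.
- apply: complexI; rewrite rE fourier_principal.
  by rewrite rmorphM/= fmorphV.
- by rewrite fourier_principal => /complexI/eqP; rewrite gt_eqF.
- by rewrite fourier_principal rE rmorphM/= fmorphV.
Qed.

(* The class [C] is described by sign conditions away from [0]: at [0] a      *)
(* function with nonnegative transform is automatically nonnegative.          *)
Definition sign_described C P N : Prop :=
  [/\ forall x, P (- x) = P x, forall x, N (- x) = N x, ~~ P 0, ~~ N 0 &
      forall f, fourier_nonneg f -> 0 < \sum_x f x ->
        (C f <-> sign_class P N f)].

Lemma minimum_quotients_attained C P N : sign_described C P N ->
  exists f g : G -> R,
    [/\ [/\ fourier_nonneg f, 0 < \sum_x f x, sign_class P N f &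
            minimum (quotients C) = f 0 / \sum_x f x],
        [/\ fourier_nonneg g, 0 < \sum_x g x & dual_sign_class P N g] &
        #|G|%:R * minimum (quotients C) * g 0 <= \sum_x g x].
Proof.
move=> [symP symN P0 N0 CE].
have [f [g [[f_ge0 sum_f fPN] [g_ge0 sum_g gPN] fg]]] :=
  exists_dual_pair R symP symN P0 N0.
have minE : minimum (quotients C) = f 0 / \sum_x f x.
  apply: minimumE; first by apply/quotientsP; exists f; split=> //; exact/CE.
  move=> _ /quotientsP[h [/CE hPN h_ge0 sum_h ->]].
  have [hP hN] := hPN h_ge0 sum_h.
  have [_ sum_hg] := fourier_nonneg_mul h_ge0 g_ge0.
  have hg0 : \sum_x h x * g x <= h 0 * g 0.
    rewrite (bigD1 0)//= gerDl; apply: sumr_le0 => x x0.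
    have [Px|Px] := boolP (P x); have [Nx|Nx] := boolP (N x).
    - have -> : h x = 0 by apply/eqP; rewrite eq_le hN// hP.
      by rewrite mul0r.
    - by rewrite mulr_ge0_le0 ?hP// gPN.2//= Nx.
    - by rewrite mulr_le0_ge0 ?hN// gPN.1//= Px.
    - have -> : g x = 0 by apply/eqP; rewrite eq_le gPN.1 ?gPN.2//= ?Px ?Nx.
      by rewrite mulr0.
  rewrite ler_pdivrMr// mulrAC ler_pdivlMr//.
  have g0 := fourier_nonneg_at0_gt0 g_ge0 sum_g.
  have card_gt0 : 0 < #|G|%:R :> R by rewrite ltr0n card_group_gt0.
  rewrite -(ler_pM2r (mulr_gt0 card_gt0 g0)).
  have le1 : (\sum_x h x) * (\sum_x g x) <= #|G|%:R * (h 0 * g 0).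
    by apply: le_trans sum_hg _; rewrite ler_pM2l.
  apply: (@le_trans _ _ ((\sum_x h x) * ((\sum_x f x) * (\sum_x g x)))).
    by rewrite mulrAC mulrC ler_pM2l//; apply: le_trans fg;
      rewrite mulrA [f 0 * _]mulrC.
  by rewrite mulrCA [X in _ <= X](_ :
      _ = (\sum_x f x) * (#|G|%:R * (h 0 * g 0)));
    [rewrite ler_pM2l | ring].
exists f, g; split=> //; rewrite minE.
by rewrite mulrA mulrAC ler_pdivrMr// [X in _ <= X]mulrC.
Qed.

(* Weak duality for [f], attaining the minimum over [C], against the product  *)
(* of the dual functions of [C1] and [C2].                                    *)
Lemma minimum_quotients_mul C C1 C2 P N P1 N1 P2 N2 :
    sign_described C P N -> sign_described C1 P1 N1 ->
    sign_described C2 P2 N2 ->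
    (forall f g1 g2 : G -> R, sign_class P N f -> dual_sign_class P1 N1 g1 ->
      dual_sign_class P2 N2 g2 -> forall x, x != 0 -> f x * g1 x * g2 x <= 0) ->
  minimum (quotients C1) * minimum (quotients C2) <= minimum (quotients C).
Proof.
move=> /minimum_quotients_attained[f [_ [[f_ge0 sum_f fPN ->] _ _]]].
move=> /minimum_quotients_attained[_ [g1 [_ [g1_ge0 sum_g1 g1PN] m1P]]].
move=> /minimum_quotients_attained[f2 [g2 [[f2_ge0 sum_f2 _ m2E]]]].
move=> [g2_ge0 sum_g2 g2PN] m2P fgg.
have [fg1_ge0 le1] := fourier_nonneg_mul f_ge0 g1_ge0.
have [_ le2] := fourier_nonneg_mul fg1_ge0 g2_ge0.
have le3 : \sum_x f x * g1 x * g2 x <= f 0 * g1 0 * g2 0.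
  by rewrite (bigD1 0)//= gerDl; apply: sumr_le0 => x x0; exact: fgg.
have card_gt0 : 0 < #|G|%:R :> R by rewrite ltr0n card_group_gt0.
have g1_0 := fourier_nonneg_at0_gt0 g1_ge0 sum_g1.
have g2_0 := fourier_nonneg_at0_gt0 g2_ge0 sum_g2.
have m2_ge0 : 0 <= minimum (quotients C2).
  by rewrite m2E divr_ge0// ltW// fourier_nonneg_at0_gt0.
move: m1P m2P m2_ge0; set m1 := minimum _; set m2 := minimum _ => m1P m2P m2_ge0.
rewrite ler_pdivlMr//.
have c_gt0 : 0 < #|G|%:R * g1 0 * (#|G|%:R * g2 0) by rewrite !mulr_gt0.
rewrite -(ler_pM2r c_gt0).
apply: (@le_trans _ _ ((\sum_x f x) * (\sum_x g1 x) * (\sum_x g2 x))).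
  rewrite [X in X <= _](_ : _ = (\sum_x f x) *
    ((#|G|%:R * m1 * g1 0) * (#|G|%:R * m2 * g2 0))); last by ring.
  rewrite -[X in _ <= X]mulrA ler_pM2l//.
  apply: (@le_trans _ _ ((\sum_x g1 x) * (#|G|%:R * m2 * g2 0))).
    by rewrite ler_wpM2r// !mulr_ge0// ltW.
  by rewrite ler_pM2l.
apply: (@le_trans _ _ (#|G|%:R * (\sum_x f x * g1 x) * (\sum_x g2 x))).
  by rewrite ler_pM2r.
rewrite -[X in X <= _]mulrA [X in _ <= X](_ :
  _ = #|G|%:R * (#|G|%:R * (f 0 * g1 0 * g2 0)));
  last by ring.
by rewrite ler_pM2l//; apply: le_trans le2 _; rewrite ler_pM2l.
Qed.

Lemma standard_setN A x : standard_set A -> (- x \in A) = (x \in A).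
Proof.
move=> [AN _]; rewrite [in LHS]AN.
by rewrite (mem_imset _ _ oppr_inj).
Qed.

Lemma sum_gt0_not_identically_zero (f : G -> R) :
  0 < \sum_x f x -> not_identically_zero f.
Proof.
move=> sum_f; case: (pickP (fun x => f x != 0)) => [x /eqP fx|f0].
  by exists x.
move: sum_f; rewrite big1 ?ltxx// => x _.
by apply/eqP/negbFE; rewrite f0.
Qed.

Lemma class_S_described A : standard_set A ->
  sign_described (@class_S R G A) [pred x | x \notin A] [pred x | x \notin A].
Proof.
move=> AP; split=> /= [x|x||| f f_ge0 sum_f]; rewrite ?standard_setN ?AP.2//.
split=> [[_ fA]|[fP fN]].
  by split=> x /= /fA->.
split; first exact: sum_gt0_not_identically_zero.
by move=> x xA; apply/eqP; rewrite eq_le fN// fP.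
Qed.

Lemma class_S_minus_described A : standard_set A ->
  sign_described (@class_S_minus R G A) pred0 [pred x | x \notin A].
Proof.
move=> AP; split=> /= [x|x||| f f_ge0 sum_f]; rewrite ?standard_setN ?AP.2//.
split=> [[_ fA]|[fP fN]]; split=> //.
exact: sum_gt0_not_identically_zero.
Qed.

(** Vanishing off [A] is encoded by overlapping conditions: [f >= 0] away from 0 and [f <= 0] off
    [A]. *)
Lemma class_S_plus_described A : standard_set A ->
  sign_described (@class_S_plus R G A)
    [pred x | x != 0] [pred x | x \notin A].
Proof.
move=> AP; split=> /= [x|x||| f f_ge0 sum_f];
  rewrite ?standard_setN ?AP.2 ?oppr_eq0 ?eqxx//.
split=> [[_ fA fA']|[fP fN]]; split=> //.
- by move=> x _; have [/fA'|/fA->] := boolP (x \in A).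
- by move=> x /= /fA->.
- exact: sum_gt0_not_identically_zero.
- move=> x xA; apply/eqP; rewrite eq_le fN// fP//=.
  by apply: contraNneq xA => ->; exact: AP.2.
- move=> x _; have [->|x0] := eqVneq x 0; last exact: fP.
  exact/ltW/fourier_nonneg_at0_gt0.
Qed.

Lemma class_S_pm_described A : standard_set A ->
  sign_described (@class_S_pm R G A)
    [pred x | x \in A & x != 0] [pred x | x \notin A].
Proof.
move=> AP; split=> /= [x|x||| f f_ge0 sum_f];
  rewrite ?standard_setN ?AP.2 ?oppr_eq0 ?eqxx//.
split=> [[_ fA fA']|[fP fN]]; split=> //.
- by move=> x /= /andP[/fA'].
- exact: sum_gt0_not_identically_zero.
- move=> x xA; have [->|x0] := eqVneq x 0; last by apply: fP; rewrite /= xA.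
  exact/ltW/fourier_nonneg_at0_gt0.
Qed.

Lemma standard_setU A B :
  standard_set A -> standard_set B -> standard_set (A :|: B).
Proof.
by move=> [AN A0] [BN _]; split; rewrite ?imsetU -?AN -?BN// inE A0.
Qed.

End MinimumQuotients.

Theorem theorem6p4 (R : realType) (G : finZmodType) (q : nat)
    (hq : #|G| = q) (A1 A2 : {set G})
    (hA1 : standard_set A1) (hA2 : standard_set A2) :
  [/\ lambda R A1 * lambda R A2 <= lambda R (A1 :|: A2),
      lambda_plus R A1 * lambda_minus R A2 <= lambda_plus R (A1 :|: A2),
      lambda_minus R A1 * lambda_minus R A2 <= lambda_minus R (A1 :|: A2) &
      lambda_pm R A1 * lambda_minus R A2 <= lambda_pm R (A1 :|: A2)].
Proof.
have hA := standard_setU hA1 hA2.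
split.
- apply: minimum_quotients_mul (class_S_described R hA)
    (class_S_described R hA1) (class_S_described R hA2) _.
  move=> f g1 g2 [/= fP fN] [/= g1P g1N] [/= g2P g2N] x x0.
  have [xA1|xA1] := boolP (x \in A1).
    rewrite (_ : g1 x = 0) ?mulr0 ?mul0r//.
    by apply/eqP; rewrite eq_le g1N ?g1P// xA1.
  have [xA2|xA2] := boolP (x \in A2).
    rewrite (_ : g2 x = 0) ?mulr0//.
    by apply/eqP; rewrite eq_le g2N ?g2P// xA2.
  rewrite (_ : f x = 0) ?mul0r//.
  by apply/eqP; rewrite eq_le fN ?fP// inE negb_or xA1.
- apply: minimum_quotients_mul (class_S_plus_described R hA)
    (class_S_plus_described R hA1) (class_S_minus_described R hA2) _.
  move=> f g1 g2 [/= fP fN] [/= g1P g1N] [/= g2P g2N] x x0.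
  have [xA2|xA2] := boolP (x \in A2).
    rewrite (_ : g2 x = 0) ?mulr0//.
    by apply/eqP; rewrite eq_le g2N ?g2P// xA2.
  rewrite mulr_le0_ge0 ?g2P//.
  have [xA1|xA1] := boolP (x \in A1).
    by rewrite mulr_ge0_le0 ?fP ?g1N ?xA1.
  rewrite (_ : f x = 0) ?mul0r//.
  by apply/eqP; rewrite eq_le fN ?fP// inE negb_or xA1.
- apply: minimum_quotients_mul (class_S_minus_described R hA)
    (class_S_minus_described R hA1) (class_S_minus_described R hA2) _.
  move=> f g1 g2 [/= _ fN] [/= g1P g1N] [/= g2P g2N] x x0.
  have [xA1|xA1] := boolP (x \in A1).
    rewrite (_ : g1 x = 0) ?mulr0 ?mul0r//.
    by apply/eqP; rewrite eq_le g1N ?g1P// xA1.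
  have [xA2|xA2] := boolP (x \in A2).
    rewrite (_ : g2 x = 0) ?mulr0//.
    by apply/eqP; rewrite eq_le g2N ?g2P// xA2.
  rewrite mulr_le0_ge0 ?g2P// mulr_le0_ge0 ?g1P//.
  by rewrite fN// inE negb_or xA1.
- apply: minimum_quotients_mul (class_S_pm_described R hA)
    (class_S_pm_described R hA1) (class_S_minus_described R hA2) _.
  move=> f g1 g2 [/= fP fN] [/= g1P g1N] [/= g2P g2N] x x0.
  have [xA2|xA2] := boolP (x \in A2).
    rewrite (_ : g2 x = 0) ?mulr0//.
    by apply/eqP; rewrite eq_le g2N ?g2P// xA2.
  rewrite mulr_le0_ge0 ?g2P//.
  have [xA1|xA1] := boolP (x \in A1).
    by rewrite mulr_ge0_le0 ?fP ?g1N ?inE ?xA1.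
  by rewrite mulr_le0_ge0 ?fN ?g1P ?inE ?negb_or ?(negPf xA1).
Qed.
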